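(* For every real $z>0$, \[ 1 < \frac{\Gamma(z)}{\sqrt{2\pi}\, z^{z-\frac12}e^{-z}} < 1+\frac{1}{12z}+\frac{1}{288z^2}. \]
   Context: $\Gamma$ is the Euler gamma function. *)

(* Defs.v *)
From HB Require Import structures.
From mathcomp Require Import all_boot all_order all_algebra.
From mathcomp Require Import all_classical all_reals all_analysis.
Set Implicit Arguments.
Unset Strict Implicit.
Unset Printing Implicit Defensive.
Import Order.TTheory GRing.Theory Num.Theory.
Import numFieldNormedType.Exports.
Local Open Scope classical_set_scope.
Local Open Scope ring_scope.

(* Euler's integral of the second kind.  This is the Gamma function for [0 < z]
   only: for [z <= 0] the integral is [+oo], which [Rintegral] sends to [0]. *)
Definition Gamma (R : realType) (z : R) : R :=
  \int[@lebesgue_measure R]_(t in `]0, +oo[) (t `^ (z - 1) * expR (- t)).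

(* Main.v *)
Require Import Defs.
From HB Require Import structures.
From mathcomp Require Import all_boot all_order all_algebra.
From mathcomp Require Import all_classical all_reals all_analysis.
From mathcomp Require Import measurable_realfun.
From mathcomp Require Import ring lra.
Set Implicit Arguments.
Unset Strict Implicit.
Unset Printing Implicit Defensive.
Import Order.TTheory GRing.Theory Num.Theory.
Import numFieldNormedType.Exports.
Local Open Scope classical_set_scope.
Local Open Scope ring_scope.

(* Write r(z) for the quotient to be bounded and
   q(z) = 1 + 1/(12 z) + 1/(288 z^2).
   The functional equation gives r(z) = c(z) r(z + 1) with
   c(z) = (1 + 1/z)^(z + 1/2) / e.  Laplace's method, i.e. the substitution
   t = z + sqrt(z) u in the integral for Gamma(z + 1) followed by dominated
   convergence to the Gaussian integral, gives r(z + n) --> 1.  Telescoping, the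
   bounds 1 < r(z) < q(z) follow from the elementary inequalities
   1 < c(z) < q(z) / q(z + 1). *)

(** * Logarithmic inequalities from the sign of derivatives *)

(** Mean value theorem on [[0, x]]. Positivity of [df] is asked only off 0 because the derivatives
    used below vanish at 0. *)
Lemma derive_gt0_gt0 (R : realType) (f df : R -> R) (x : R) :
  (forall t : R, 0 <= t -> is_derive t 1 f (df t)) ->
  (forall t : R, 0 < t -> 0 < df t) -> f 0 = 0 -> 0 < x -> 0 < f x.
Proof.
move=> fE df_gt0 f0 x_gt0.
have [t tx|t|c cx] := @MVT R f df 0 x x_gt0.
- by apply: fE; rewrite ltW// (itvP tx).
- apply: derivable_within_continuous => u ux.
  have : 0 <= u by rewrite (itvP ux).
  by move=> /fE[].
- rewrite f0 !subr0 => ->.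
  by rewrite mulr_gt0// df_gt0// (itvP cx).
Qed.

Lemma is_derive_ln_comp (R : realType) (f : R -> R) (df x : R) :
  is_derive x 1 f df -> 0 < f x -> is_derive x 1 (fun t => ln (f t)) (df / f x).
Proof.
move=> fE fx_gt0.
rewrite mulrC; exact: (is_derive1_comp (is_derive1_ln fx_gt0) fE).
Qed.

(** At x = 1/z the left side is 1/(z + 1/2), so this is c(z) > 1 after taking logarithms. *)
Lemma ln1D_gt (R : realType) (x : R) : 0 < x -> 2 * x / (2 + x) < ln (1 + x).
Proof.
move=> x_gt0; rewrite -subr_gt0.
(* The fraction 2 t/(2 + t) is rewritten as 2 - 4/(2 + t), which leaves a single inverse to
   differentiate. *)
pose f (t : R) := ln (1 + t) + (4 * (2 + t)^-1 - 2).
have -> : ln (1 + x) - 2 * x / (2 + x) = f x.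
  have x2 : 0 < 2 + x by lra.
  by rewrite /f; field; rewrite gt_eqF.
pose df (t : R) := t ^+ 2 / ((1 + t) * (2 + t) ^+ 2).
apply: (@derive_gt0_gt0 _ f df) => // [t t_ge0|t t_gt0|].
- have h1 : 0 < 1 + t by lra.
  have h2 : 0 < 2 + t by lra.
  have h3 : is_derive t 1 (fun u : R => 1 + u) 1.
    by apply: is_derive_eq; ring.
  have h4 : is_derive t 1 (fun u : R => 2 + u) 1.
    by apply: is_derive_eq; ring.
  have h5 := is_derive_ln_comp h3 h1.
  have h6 := is_deriveV (lt0r_neq0 h2) h4.
  apply: is_derive_eq.
  rewrite /df /= /GRing.scale /=.
  by field; rewrite !gt_eqF.
- by rewrite /df divr_gt0 ?exprn_gt0 ?mulr_gt0 ?exprn_gt0//; lra.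
- by rewrite /f !addr0 ln1; field.
Qed.

(* With y = 1/(12 z), the upper bound of the theorem is (2 + 2 y + y^2) / 2 and
   its value at z + 1 is (2 + 50 y + 313 y^2) / (2 (1 + 12 y)^2). *)
Definition upper_gap (R : realType) (y : R) : R :=
  12 * y * (1 + ln (2 + 2 * y + y ^+ 2) - ln (2 + 50 * y + 313 * y ^+ 2))
  + (18 * y - 1) * ln (1 + 12 * y).

(** [upper_gap y] is 12 y = 1/z times the logarithm of q(z) / (c(z) q(z + 1)). The factor makes the
    coefficients of the logarithms affine in y, so the second derivative is rational. It is positive
    for y > 0, while the function and its first derivative vanish at 0. *)
Lemma upper_gap_gt0 (R : realType) (y : R) : 0 < y -> 0 < upper_gap y.
Proof.
pose a (t : R) := 2 + 2 * t + t ^+ 2.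
pose b (t : R) := 2 + 50 * t + 313 * t ^+ 2.
pose u (t : R) := 1 + 12 * t.
(* This is the numerator in a'/a - b'/b = - 96 n / (a b), which explains 1152 = 12 * 96 in [dk]. *)
pose n (t : R) := 1 + 13 * t + 6 * t ^+ 2.
have aE (t : R) : is_derive t 1 a (2 + 2 * t).
  by apply: is_derive_eq; rewrite /GRing.scale /=; ring.
have bE (t : R) : is_derive t 1 b (50 + 626 * t).
  by apply: is_derive_eq; rewrite /GRing.scale /=; ring.
have uE (t : R) : is_derive t 1 u 12.
  by apply: is_derive_eq; rewrite /GRing.scale /=; ring.
have nE (t : R) : is_derive t 1 n (13 + 12 * t).
  by apply: is_derive_eq; rewrite /GRing.scale /=; ring.
have a_gt0 (t : R) : 0 <= t -> 0 < a t by rewrite /a; nra.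
have b_gt0 (t : R) : 0 <= t -> 0 < b t by rewrite /b; nra.
have u_gt0 (t : R) : 0 <= t -> 0 < u t by rewrite /u; nra.
pose dk (t : R) := 12 * (1 + ln (a t) - ln (b t)) + 18 * ln (u t)
  + (12 * (18 * t - 1) / u t - 1152 * t * (n t / (a t * b t))).
(* The large coefficients are split in base 1000 because numerals are unary. *)
pose p (t : R) := (6 * 1000 + 672) + (267 * 1000 + 240) * t
  + (3713 * 1000 + 748) * t ^+ 2
  + ((19 * 1000 + 798) * 1000 + 608) * t ^+ 3
  + ((27 * 1000 + 204) * 1000 + 528) * t ^+ 4
  + ((12 * 1000 + 13) * 1000 + 566) * t ^+ 5
  + (2645 * 1000 + 163) * t ^+ 6.
(* The second derivative over a common denominator. The factor t^3 reflects the agreement of q with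
   the Stirling series up to 1/z^2; the cofactor [p] has only positive coefficients. *)
pose ddk (t : R) := 96 * t ^+ 3 * p t / (a t ^+ 2 * b t ^+ 2 * u t ^+ 2).
have p_gt0 (t : R) : 0 < t -> 0 < p t.
  (* Abstract coefficients keep the rewriting from descending into the large numerals. *)
  have poly_gt0 (c0 c1 c2 c3 c4 c5 c6 : R) : 0 < c0 -> 0 < c1 -> 0 < c2 ->
      0 < c3 -> 0 < c4 -> 0 < c5 -> 0 < c6 -> 0 < t ->
      0 < c0 + c1 * t + c2 * t ^+ 2 + c3 * t ^+ 3 + c4 * t ^+ 4 + c5 * t ^+ 5
        + c6 * t ^+ 6.
    by move=> *; rewrite !addr_gt0 ?mulr_gt0 ?exprn_gt0.
  by apply: poly_gt0; lra.
have dkE (t : R) : 0 <= t -> is_derive t 1 dk (ddk t).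
  move=> t_ge0.
  have ha := a_gt0 _ t_ge0; have hb := b_gt0 _ t_ge0; have hu := u_gt0 _ t_ge0.
  have lna := is_derive_ln_comp (aE t) ha.
  have lnb := is_derive_ln_comp (bE t) hb.
  have lnu := is_derive_ln_comp (uE t) hu.
  have ua := is_deriveV (lt0r_neq0 ha) (aE t).
  have ub := is_deriveV (lt0r_neq0 hb) (bE t).
  have uu := is_deriveV (lt0r_neq0 hu) (uE t).
  (* Splitting the inverse of a b lets instance inference use the derivatives of the separate
     inverses recorded just above. *)
  have e : dk = fun t : R => 12 * (1 + ln (a t) - ln (b t)) + 18 * ln (u t)
  + (12 * (18 * t - 1) * (u t)^-1 - 1152 * t * (n t * ((a t)^-1 * (b t)^-1))).
    by apply/funext => s; rewrite /dk invfM.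
  rewrite e; apply: is_derive_eq.
  rewrite /GRing.scale /=.
  have -> : ddk t =
      96 * t ^+ 3 * p t * (a t)^-1 ^+ 2 * (b t)^-1 ^+ 2 * (u t)^-1 ^+ 2.
    by rewrite /ddk; field; rewrite !gt_eqF.
  rewrite /p /dk /n; move: ha hb hu; rewrite /a /b /u => ha hb hu.
  by field; rewrite !gt_eqF.
have kE (t : R) : 0 <= t -> is_derive t 1 (@upper_gap R) (dk t).
  move=> t_ge0.
  have ha := a_gt0 _ t_ge0; have hb := b_gt0 _ t_ge0; have hu := u_gt0 _ t_ge0.
  have lna := is_derive_ln_comp (aE t) ha.
  have lnb := is_derive_ln_comp (bE t) hb.
  have lnu := is_derive_ln_comp (uE t) hu.
  rewrite (_ : @upper_gap R = fun t : R =>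
    12 * t * (1 + ln (a t) - ln (b t)) + (18 * t - 1) * ln (u t)) //.
  apply: is_derive_eq; rewrite /GRing.scale /= /dk /n.
  move: (ln (a t)) (ln (b t)) (ln (u t)) => la lb lu.
  move: ha hb hu; rewrite /a /b /u => ha hb hu.
  by field; rewrite !gt_eqF.
have dk_gt0 (t : R) : 0 < t -> 0 < dk t.
  apply: (derive_gt0_gt0 dkE) => [s s_gt0|].
    have s_ge0 := ltW s_gt0.
    by rewrite /ddk divr_gt0// ?mulr_gt0 ?exprn_gt0// ?p_gt0 ?a_gt0 ?b_gt0 ?u_gt0.
  rewrite /dk /a /b /u !mulr0 !expr0n/= !mulr0 !addr0 !mul0r ln1 invr1.
  ring.
apply: (derive_gt0_gt0 kE dk_gt0).
rewrite /upper_gap !mulr0 mul0r addr0 ln1 mulr0 addr0 //.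
Qed.

Lemma derive_ge0_le (R : realType) (f df : R -> R) (a x y : R) :
  (forall t : R, a < t -> is_derive t 1 f (df t)) ->
  (forall t : R, a < t -> 0 <= df t) -> a < x -> x <= y -> f x <= f y.
Proof.
move=> fE df_ge0 ax xy; rewrite -subr_ge0.
have [t txy|t|c cxy ->] := @MVT_segment R f df x y xy.
- by apply: fE; rewrite (lt_trans ax)// (itvP txy).
- apply: derivable_within_continuous => u uxy.
  have : a < u by rewrite (lt_le_trans ax)// (itvP uxy).
  by move=> /fE[].
- by rewrite mulr_ge0 ?subr_ge0// df_ge0// (lt_le_trans ax)// (itvP cxy).
Qed.

Section ln1D_bounds.
Context {R : realType}.
Implicit Types v x y : R.

Let ln1DE v : -1 < v -> is_derive v 1 (fun t : R => ln (1 + t)) ((1 + v)^-1).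
Proof.
move=> v_gt; have h1 : 0 < 1 + v by lra.
have h2 : is_derive v 1 (fun u : R => 1 + u) 1.
  by apply: is_derive_eq; ring.
by have := is_derive_ln_comp h2 h1; rewrite mul1r.
Qed.

(** The derivative is t^2/(1 + t). Monotonicity on both sides of 0 is kept because comparison with 0
    gives a lower or an upper bound according to the sign of the variable. *)
Lemma ln1D_sub_le x y : -1 < x -> x <= y ->
  ln (1 + x) - x + x ^+ 2 / 2 <= ln (1 + y) - y + y ^+ 2 / 2.
Proof.
apply: (@derive_ge0_le _ (fun t => ln (1 + t) - t + t ^+ 2 / 2)
  (fun t => t ^+ 2 / (1 + t))) => t t_gt.
  have := ln1DE t_gt => h; apply: is_derive_eq; rewrite /GRing.scale /=.
  by field; rewrite gt_eqF//; lra.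
by rewrite divr_ge0 ?sqr_ge0//; lra.
Qed.

(** Companion bound: here the derivative is - t^2/(2 (1 + t)^2). *)
Lemma ln1D_sub_ge x y : -1 < x -> x <= y ->
  ln (1 + y) - y + y ^+ 2 / (2 * (1 + y)) <=
  ln (1 + x) - x + x ^+ 2 / (2 * (1 + x)).
Proof.
move=> x_gt xy; rewrite -lerN2; move: x_gt xy.
apply: (@derive_ge0_le _ (fun t => - (ln (1 + t) - t + t ^+ 2 / (2 * (1 + t))))
  (fun t => t ^+ 2 / (2 * (1 + t) ^+ 2))) => t t_gt.
  have h := ln1DE t_gt.
  have h1 : 0 < 2 * (1 + t) by lra.
  have h2 : is_derive t 1 (fun u : R => 2 * (1 + u)) 2.
    by apply: is_derive_eq; rewrite /GRing.scale /=; ring.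
  have h3 := @is_deriveV _ (fun u : R => 2 * (1 + u)) t 2 1 (lt0r_neq0 h1) h2.
  apply: is_derive_eq; rewrite /GRing.scale /=.
  by field; rewrite gt_eqF//; lra.
rewrite divr_ge0 ?sqr_ge0// mulr_ge0 ?sqr_ge0//.
Qed.

End ln1D_bounds.

(** * The Laplace integrand: pointwise limit and domination *)

(** The quotient of t^z e^(-t) by its value z^z e^(-z) at t = z, after t = z + sqrt(z) u. The test
    says t > 0; elsewhere the value is 0. *)
Definition laplace (R : realType) (z u : R) : R :=
  if - Num.sqrt z < u
  then expR (z * (ln (1 + u / Num.sqrt z) - u / Num.sqrt z)) else 0.

Section laplace_bounds.
Context {R : realType}.
Implicit Types z u s : R.

Lemma laplace_ge0 z u : 0 <= laplace z u.
Proof. by rewrite /laplace; case: ifP => // _; exact: expR_ge0. Qed.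

(** Multiply the two monotonicity lemmas, compared with 0 at v = u/s, by s^2. With s = sqrt(z), one
    bound is the limit exponent and the other tends to it, which serves both the squeeze and the
    domination. *)
Lemma laplace_expo_bounds s u : 0 < s -> - s < u ->
  let a := - u ^+ 2 / 2 in let b := - u ^+ 2 / (2 * (1 + u / s)) in
  let e := s ^+ 2 * (ln (1 + u / s) - u / s) in
  (0 <= u -> a <= e <= b) /\ (u <= 0 -> b <= e <= a).
Proof.
move=> s_gt0 su /=.
have sN0 : s != 0 by rewrite gt_eqF.
have v_gt : -1 < u / s by rewrite ltr_pdivlMr// mulN1r.
have v1_gt0 : 0 < 1 + u / s by lra.
have aE : - u ^+ 2 / 2 = s ^+ 2 * (- ((u / s) ^+ 2 / 2)) by field.
have bE : - u ^+ 2 / (2 * (1 + u / s)) =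
    s ^+ 2 * (- ((u / s) ^+ 2 / (2 * (1 + u / s)))).
  have su_gt0 : 0 < s + u by lra.
  by field; rewrite sN0 gt_eqF.
have s2_gt0 : 0 < s ^+ 2 by rewrite exprn_gt0.
have zero1 : ln (1 + 0) - 0 + 0 ^+ 2 / 2 = 0 :> R.
  by rewrite addr0 ln1; ring.
have zero2 : ln (1 + 0) - 0 + 0 ^+ 2 / (2 * (1 + 0)) = 0 :> R.
  by rewrite addr0 ln1 expr0n /= mul0r; ring.
have N10 : -1 < 0 :> R by lra.
rewrite aE bE; split=> hu; rewrite !ler_pM2l//.
- have v_ge0 : 0 <= u / s by rewrite divr_ge0// ltW.
  have := ln1D_sub_le N10 v_ge0; have := ln1D_sub_ge N10 v_ge0.
  by rewrite zero1 zero2 => ? ?; apply/andP; split; lra.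
- have v_le0 : u / s <= 0 by rewrite pmulr_lle0 ?invr_gt0.
  have := ln1D_sub_le v_gt v_le0; have := ln1D_sub_ge v_gt v_le0.
  by rewrite zero1 zero2 => ? ?; apply/andP; split; lra.
Qed.

Lemma laplace_cvg (z : R ^nat) u : z @ \oo --> +oo ->
  laplace (z n) u @[n --> \oo] --> expR (- u ^+ 2 / 2).
Proof.
move=> z_oo.
have z_gt0 : \forall n \near \oo, 0 < z n by exact: (cvgry_gt z_oo).
have sV0 : (Num.sqrt (z n))^-1 @[n --> \oo] --> (0 : R).
  have zV0 : (z n)^-1 @[n --> \oo] --> (0 : R) by apply/gtr0_cvgV0.
  have := cvg_comp _ _ zV0 (@sqrt_continuous R 0); rewrite sqrtr0.
  apply: cvg_trans; apply: near_eq_cvg.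
  by apply: filterS z_gt0 => n /ltW zn /=; rewrite sqrtrV.
have v0 : 1 + u / Num.sqrt (z n) @[n --> \oo] --> (1 : R).
  rewrite -[X in _ --> X](_ : 1 + u * 0 = 1); last by rewrite mulr0 addr0.
  by apply: cvgD; [exact: cvg_cst|apply: cvgM => //; exact: cvg_cst].
have b_cvg : - u ^+ 2 / (2 * (1 + u / Num.sqrt (z n))) @[n --> \oo] -->
    - u ^+ 2 / 2.
  rewrite -[X in _ --> X](_ : - u ^+ 2 * (2 * 1)^-1 = _); last by rewrite mulr1.
  apply: cvgM; first exact: cvg_cst.
  apply: cvgV; first by rewrite mulr1.
  by apply: cvgM => //; exact: cvg_cst.
have su : \forall n \near \oo, - Num.sqrt (z n) < u.
  have v_gt0 : \forall n \near \oo, 0 < 1 + u / Num.sqrt (z n).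
    have /cvgrPdist_lt/(_ 1 ltr01) := v0.
    by apply: filterS => n; rewrite ltr_norml => /andP[]; lra.
  apply: filterS2 z_gt0 v_gt0 => n zn vn.
  have sn : 0 < Num.sqrt (z n) by rewrite sqrtr_gt0.
  have := mulr_gt0 vn sn; rewrite mulrDl mul1r divfK ?gt_eqF//.
  by move=> ?; lra.
have lapE : \forall n \near \oo,
    expR (z n * (ln (1 + u / Num.sqrt (z n)) - u / Num.sqrt (z n))) =
    laplace (z n) u.
  by apply: filterS su => n sn; rewrite /laplace sn.
apply: cvg_trans; first exact: (near_eq_cvg lapE).
apply: (cvg_comp _ expR); last exact: continuous_expR.
have [u0|u0] := leP 0 u.
- apply: (squeeze_cvgr _ (cvg_cst _) b_cvg).
  apply: filterS2 z_gt0 su => n zn sn.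
  have s_gt0 : 0 < Num.sqrt (z n) by rewrite sqrtr_gt0.
  have [/(_ u0) + _] := laplace_expo_bounds s_gt0 sn.
  by rewrite (sqr_sqrtr (ltW zn)).
- apply: (squeeze_cvgr _ b_cvg (cvg_cst _)).
  apply: filterS2 z_gt0 su => n zn sn.
  have s_gt0 : 0 < Num.sqrt (z n) by rewrite sqrtr_gt0.
  have [_ /(_ (ltW u0))] := laplace_expo_bounds s_gt0 sn.
  by rewrite (sqr_sqrtr (ltW zn)).
Qed.

(** A majorant independent of z. For u >= 0, sqrt(z) >= 1 gives v = u/sqrt(z) <= u, hence - u^2/(2
    (1 + v)) <= - u^2/(2 (1 + u)) <= (1 - u)/2. For u < 0 the Gaussian itself dominates. *)
Lemma laplace_le z u : 1 <= z ->
  laplace z u <=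
  expR (- u ^+ 2 / 2) + (if 0 <= u then expR ((1 - u) / 2) else 0).
Proof.
move=> z_ge1; have z_gt0 : 0 < z by lra.
have s_ge1 : 1 <= Num.sqrt z by rewrite -sqrtr1 ler_wsqrtr.
rewrite /laplace; case: ifPn => [su|_]; last first.
  by rewrite addr_ge0 ?expR_ge0//; case: ifP => // _; exact: expR_ge0.
have s_gt0 : 0 < Num.sqrt z by lra.
have [] := laplace_expo_bounds s_gt0 su; rewrite (sqr_sqrtr (ltW z_gt0)).
case: leP => u0 h1 h2.
- have /andP[_ h] := h1 isT.
  rewrite ler_wpDl ?expR_ge0// ler_expR (le_trans h)//.
  have v_ge0 : 0 <= u / Num.sqrt z by rewrite divr_ge0// ltW.
  have v_le : u / Num.sqrt z <= u by rewrite ler_pdivrMr// ler_peMr.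
  move: v_ge0 v_le; set v := u / _ => v_ge0 v_le.
  have v1 : 0 < 2 * (1 + v) by lra.
  by rewrite ler_pdivrMr//; nra.
- have /andP[_ h] := h2 (ltW u0).
  by rewrite addr0 ler_expR.
Qed.

End laplace_bounds.

(** * The Gamma integrand as a continuous function on the line *)

(** With exponent z this is the integrand of Gamma(z + 1). Extension by 0 makes it continuous on the
    whole line when z > 0, as the substitution over the line requires. *)
Definition gamma_fun (R : realType) (z t : R) : R :=
  if 0 < t then t `^ z * expR (- t) else 0.

Section gamma_fun.
Context {R : realType}.
Implicit Types z t u : R.
Local Notation mu := (@lebesgue_measure R).

Lemma gamma_fun_ge0 z t : 0 <= gamma_fun z t.
Proof.
by rewrite /gamma_fun; case: ifP => // _; rewrite mulr_ge0 ?powR_ge0 ?expR_ge0.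
Qed.

Lemma gamma_fun_cvg0 z : 0 < z -> gamma_fun z t @[t --> 0^'+] --> 0.
Proof.
move=> z_gt0.
have E : \forall t \near 0^'+, t `^ z * expR (- t) = gamma_fun z t.
  by near=> t; rewrite /gamma_fun ifT.
apply: cvg_trans; first exact: (near_eq_cvg E).
have exp_cvg : expR (- t) @[t --> 0^'+] --> expR (- (0 : R)).
  apply: (cvg_comp (fun t : R => - t) expR); last exact: continuous_expR.
  by apply: cvgN; exact: cvg_at_right_filter.
have H := cvgM (powR_cvg0 z_gt0) exp_cvg.
by rewrite mul0r in H; exact: H.
Unshelve. all: by end_near. Qed.

Lemma continuous_gamma_fun z : 0 < z -> continuous (gamma_fun z).
Proof.
move=> z_gt0 t; have [t_lt0|t_gt0|->] := ltgtP t 0.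
- have E : \forall x \near t, 0 = gamma_fun z x.
    near=> x; rewrite /gamma_fun ifF//; apply/negbTE; rewrite -leNgt ltW//.
    by near: x; exact: lt_nbhsl.
  rewrite /continuous_at {2}/gamma_fun ifF; last first.
    by apply/negbTE; rewrite -leNgt ltW.
  by apply: cvg_trans; [exact: (near_eq_cvg E)|exact: cvg_cst].
- have E : \forall x \near t, x `^ z * expR (- x) = gamma_fun z x.
    near=> x; rewrite /gamma_fun ifT//.
    by near: x; exact: lt_nbhsr.
  rewrite /continuous_at {2}/gamma_fun t_gt0.
  apply: cvg_trans; first exact: (near_eq_cvg E).
  apply: cvgM.
    have [/derivable1_diffP/differentiable_continuous + _] := is_derive1_powR z t_gt0.
    exact.
  apply: (cvg_comp (fun x : R => - x) expR); last exact: continuous_expR.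
  by apply: cvgN; exact: cvg_id.
- apply/left_right_continuousP; rewrite {2 4}/gamma_fun ltxx; split.
    have E : \forall x \near 0^'-, 0 = gamma_fun z x.
      near=> x; rewrite /gamma_fun ifF//; apply/negbTE; rewrite -leNgt ltW//.
    by apply: cvg_trans; [exact: (near_eq_cvg E)|exact: cvg_cst].
  exact: gamma_fun_cvg0.
Unshelve. all: by end_near. Qed.

Lemma gamma_fun_affine z u : 0 < z ->
  gamma_fun z (Num.sqrt z * u + z) = z `^ z * expR (- z) * laplace z u.
Proof.
move=> z_gt0; have s_gt0 : 0 < Num.sqrt z by rewrite sqrtr_gt0.
have sN0 : Num.sqrt z != 0 by rewrite gt_eqF.
have zE : z = Num.sqrt z ^+ 2 by rewrite sqr_sqrtr ?ltW.
have affE : Num.sqrt z * u + z = z * (1 + u / Num.sqrt z).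
  by rewrite {2 3}zE; field.
rewrite /gamma_fun /laplace affE pmulr_rgt0//.
have -> : (0 < 1 + u / Num.sqrt z) = (- Num.sqrt z < u).
  by rewrite -ltrBlDl sub0r ltr_pdivlMr// mulN1r.
case: ifPn => [su|_]; last by rewrite mulr0.
have v_gt0 : 0 < 1 + u / Num.sqrt z.
  by rewrite -ltrBlDl sub0r ltr_pdivlMr// mulN1r.
rewrite powRM ?ltW// -!mulrA; congr (_ * _).
rewrite [(1 + _) `^ z]/powR gt_eqF// -!expRD; congr expR; ring.
Qed.

End gamma_fun.

(** * Change of variables and convergence to the Gaussian integral *)

Section Gamma_laplace.
Context {R : realType}.
Implicit Types z t u : R.
Local Notation mu := (@lebesgue_measure R).

(** Transported from [gamma_fun] through the affine substitution, which avoids a separate study at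
    the cut u = - sqrt(z). *)
Lemma continuous_laplace z : 0 < z -> continuous (laplace z).
Proof.
move=> z_gt0; have c_gt0 : 0 < z `^ z * expR (- z).
  by rewrite mulr_gt0 ?powR_gt0 ?expR_gt0.
have -> : laplace z = fun u =>
    (z `^ z * expR (- z))^-1 * gamma_fun z (Num.sqrt z * u + z).
  apply/funext => u; rewrite gamma_fun_affine// mulKf//; exact: lt0r_neq0.
move=> u; apply: cvgM; first exact: cvg_cst.
apply: (cvg_comp (fun u => Num.sqrt z * u + z) (gamma_fun z)).
  apply: cvgD; last exact: cvg_cst.
  by apply: cvgM; [exact: cvg_cst|exact: cvg_id].
exact: continuous_gamma_fun.
Qed.

Lemma measurable_laplace z : 0 < z -> measurable_fun setT (laplace z).
Proof.
by move=> z_gt0; apply: continuous_measurable_fun; exact: continuous_laplace.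
Qed.

Lemma Gamma_laplace z : 0 < z ->
  Gamma (z + 1) = z `^ z * expR (- z) * Num.sqrt z *
    \int[mu]_u laplace z u.
Proof.
move=> z_gt0; have s_gt0 : 0 < Num.sqrt z by rewrite sqrtr_gt0.
have c_ge0 : 0 <= z `^ z * expR (- z) * Num.sqrt z.
  by rewrite !mulr_ge0 ?powR_ge0 ?expR_ge0 ?sqrtr_ge0.
rewrite /Gamma /Rintegral -[X in X * _]/(fine (_%:E)).
(* The substitution is carried out on extended real integrals of nonnegative functions; the extra
   sqrt(z) is dt/du. *)
rewrite (_ : (\int[mu]_(t in `]0%R, +oo[)
    (t `^ (z + 1 - 1) * expR (- t))%:E)%E =
   ((z `^ z * expR (- z) * Num.sqrt z)%:E * \int[mu]_u (laplace z u)%:E)%E); last first.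
  rewrite addrK integral_mkcond.
  transitivity (\int[mu]_t (gamma_fun z t)%:E)%E.
    apply: eq_integral => t _; rewrite patchE /gamma_fun.
    rewrite (_ : (t \in `]0%R, +oo[%classic) = (0 < t)); last first.
      by apply/idP/idP; rewrite inE/= in_itv/= andbT.
    by case: ifP.
  pose F (u : R) : R := Num.sqrt z * u + z.
  have FE u : is_derive u 1 F (Num.sqrt z).
    by apply: is_derive_eq; rewrite /GRing.scale /=; ring.
  have F'E : F^`()%classic = cst (Num.sqrt z).
    by apply/funext => u; rewrite derive1E derive_val.
  rewrite (@increasing_ge0_integration_by_substitutionT _ F).
  - rewrite F'E -ge0_integralZl//=.
    + apply: eq_integral => u _; rewrite -EFinM; congr EFin.
      by rewrite !fctE /F gamma_fun_affine//; ring.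
    + by apply/measurable_EFinP; exact: measurable_laplace.
    + by move=> u _; rewrite lee_fin laplace_ge0.
  - by move=> x y xy; rewrite /F ltrD2r ltr_pM2l.
  - by rewrite F'E => ?; exact: cvg_cst.
  - by rewrite F'E; exact: is_cvg_cst.
  - by rewrite F'E; exact: is_cvg_cst.
  - by move=> u; case: (FE u).
  - rewrite /F; apply: (cvg_comp _ (fun x => x + z) _ (@cvg_addrr_Ny R z)).
    by apply/gt0_cvgMrNy => //; exact: cvg_id.
  - rewrite /F; apply: (cvg_comp _ (fun x => x + z) _ (@cvg_addrr R z)).
    by apply/gt0_cvgMry => //; exact: cvg_id.
  - exact: continuous_gamma_fun.
  - exact: gamma_fun_ge0.
(* [fine] commutes with a positive finite factor even at infinite values, where both sides become
   0. *)
have c_gt0 : 0 < z `^ z * expR (- z) * Num.sqrt z.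
  by rewrite !mulr_gt0 ?powR_gt0 ?expR_gt0.
case: (\int[mu]_u _)%E => [r||] //.
- by rewrite gt0_muley ?lte_fin// mulr0.
- by rewrite gt0_muleNy ?lte_fin// mulr0.
Qed.

(** Read off from the total mass 1 of the standard normal density, whose peak is 1/sqrt(2 pi). *)
Lemma integral_gaussian :
  (\int[mu]_u (normal_fun 0 1 u)%:E = (Num.sqrt (2 * pi))%:E)%E.
Proof.
have n1 : 1 != 0 :> R by exact: oner_neq0.
have := integral_normal_pdf 0 (1 : R).
under eq_integral do rewrite normal_pdfE// EFinM.
have peak_gt0 : 0 < normal_peak (1 : R) by exact: normal_peak_gt0.
rewrite ge0_integralZl//=; last 3 first.
- by apply/measurable_EFinP; exact: measurable_normal_fun.
- by move=> x _; rewrite lee_fin normal_fun_ge0.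
- by rewrite lee_fin ltW.
have peakE : normal_peak (1 : R) = (Num.sqrt (2 * pi))^-1.
  by rewrite /normal_peak expr1n mul1r mulr_natl.
case: (\int[mu]_u _)%E => [r||] /=.
- rewrite -EFinM => -[] rE; congr EFin.
  by rewrite -[r](mulKf (lt0r_neq0 peak_gt0)) rE mulr1 peakE invrK.
- by rewrite gt0_muley ?lte_fin.
- by rewrite gt0_muleNy ?lte_fin.
Qed.

Lemma integral_laplace_cvg (z : R ^nat) :
  (forall n, 1 <= z n) -> z @ \oo --> +oo ->
  \int[mu]_u laplace (z n) u @[n --> \oo] --> Num.sqrt (2 * pi).
Proof.
move=> z_ge1 z_oo.
have z_gt0 n : 0 < z n by exact: lt_le_trans (z_ge1 n).
have nE u : normal_fun 0 1 u = expR (- u ^+ 2 / 2).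
  by rewrite /normal_fun subr0 expr1n.
(* The tail e^((1 - u)/2) is 2 e^(1/2) times the exponential density of rate 1/2, so integrability
   of the majorant comes from known densities. *)
pose g u : R := normal_fun 0 1 u + expR (2^-1) * 2 * exponential_pdf 2^-1 u.
have lap_le n u : laplace (z n) u <= g u.
  rewrite (le_trans (laplace_le _ (z_ge1 n)))// /g nE lerD2l.
  case: ifPn => u0; last first.
    by rewrite !mulr_ge0 ?expR_ge0// exponential_pdf_ge0.
  rewrite exponential_pdfE// -!mulrA [2 * _]mulrA divff// mul1r -expRD.
  by rewrite ler_expR; lra.
have int_n : mu.-integrable setT (EFin \o normal_fun (0 : R) 1).
  apply/integrableP; split.
    by apply/measurable_EFinP; exact: measurable_normal_fun.
  under eq_integral do rewrite /= ger0_norm ?expR_ge0//.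
  by rewrite /= integral_gaussian ltry.
have int_g : mu.-integrable setT (EFin \o g).
  rewrite (_ : EFin \o g = ((EFin \o normal_fun 0 1) \+
    (fun u => (expR (2^-1) * 2)%:E * (EFin \o exponential_pdf 2^-1) u))%E); last first.
    by apply/funext => u; rewrite /g /= EFinD EFinM.
  apply: integrableD => //; apply: integrableZl => //.
  exact: integrable_exponential_pdf.
have m_lap n : measurable_fun setT (EFin \o laplace (z n)).
  by apply/measurable_EFinP; exact: measurable_laplace.
have m_n : measurable_fun setT (EFin \o normal_fun (0 : R) 1).
  by apply/measurable_EFinP; exact: measurable_normal_fun.
have cvg_lap : {ae mu, forall u, setT u ->
    (EFin \o laplace (z n)) u @[n --> \oo] --> (EFin \o normal_fun (0 : R) 1) u}.
  apply: aeW => u _ /=; rewrite nE.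
  by apply: cvg_EFin; [exact: nearW|exact: laplace_cvg].
have lap_g : {ae mu, forall u n, setT u ->
    (`|(EFin \o laplace (z n)) u| <= (EFin \o g) u)%E}.
  by apply: aeW => u n _ /=; rewrite lee_fin ger0_norm ?laplace_ge0.
have [_ _ +] := @dominated_convergence _ _ R mu setT measurableT
  (fun n => EFin \o laplace (z n)) (EFin \o normal_fun 0 1) (EFin \o g)
  m_lap m_n cvg_lap int_g lap_g.
rewrite (_ : (\int[mu]_(x in setT) (EFin \o normal_fun 0 1) x)%E =
    (Num.sqrt (2 * pi))%:E); last exact: integral_gaussian.
exact: fine_cvg.
Qed.
End Gamma_laplace.

(** * The functional equation by integration by parts *)

Section Gamma_functional_equation.
Context {R : realType}.
Implicit Types z t : R.
Local Notation mu := (@lebesgue_measure R).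

(** From ln x < x at x = t/(2 z) one gets t^z <= (2 z)^z e^(t/2), so half of the exponential decay
    remains. *)
Lemma gamma_fun_cvgy z : 0 < z -> gamma_fun z t @[t --> +oo] --> 0.
Proof.
move=> z_gt0; pose C := (2 * z) `^ z.
apply: (@squeeze_cvgr _ _ _ _ (cst 0) (fun t => C * expR (- (2^-1 * t)))).
- near=> t; rewrite gamma_fun_ge0/=.
  have t_gt0 : 0 < t by near: t; exact: nbhs_pinfty_gt.
  have r_gt0 : 0 < t / (2 * z) by rewrite divr_gt0// mulr_gt0.
  have c_gt0 : 0 < 2 * z by rewrite mulr_gt0.
  rewrite /gamma_fun t_gt0 /C {1}(_ : t = (2 * z) * (t / (2 * z))); last first.
    by rewrite mulrC divfK// gt_eqF.
  rewrite (powRM _ (ltW c_gt0) (ltW r_gt0)) -mulrA ler_pM2l ?powR_gt0//.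
  rewrite {1}/powR gt_eqF// -expRD ler_expR.
  have := ltW (ln_sublinear r_gt0); rewrite -(ler_pM2l z_gt0).
  rewrite (_ : z * (t / (2 * z)) = 2^-1 * t); last by field; rewrite gt_eqF.
  by move=> ?; lra.
- exact: cvg_cst.
- rewrite -[X in _ --> X](mulr0 C); apply: cvgM; first exact: cvg_cst.
  apply: (cvg_comp (fun t => 2^-1 * t) (fun t => expR (- t))); last exact: cvgr_expR.
  by apply: gt0_cvgMry => //; exact: cvg_id.
Unshelve. all: by end_near. Qed.

Lemma is_derive_gamma_fun z t : 0 < t ->
  is_derive t 1 (fun s : R => s `^ z * expR (- s))
    (z * (t `^ (z - 1) * expR (- t)) - t `^ z * expR (- t)).
Proof.
move=> t_gt0; have h := is_derive1_powR z t_gt0.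
have h2 : is_derive t 1 (fun s : R => expR (- s)) (- expR (- t)).
  rewrite -[X in is_derive _ _ _ X]mulrN1.
  exact: (@is_derive1_comp _ expR (fun s => - s)).
apply: is_derive_eq; rewrite /GRing.scale /=; ring.
Qed.

(** A compact exhaustion of the open half-line, away from the possible singularity of t^(z - 1) at
    0. The shift by 2 keeps the endpoints distinct at n = 0. *)
Let D n : set R := `[(n.+2%:R : R)^-1, n.+2%:R].

Let D_gt0 n t : D n t -> 0 < t.
Proof.
rewrite /D/= in_itv/= => /andP[+ _].
by apply: lt_le_trans; rewrite invr_gt0 ltr0n.
Qed.

Let bigcup_D : \bigcup_n D n = `]0, +oo[%classic.
Proof.
apply/seteqP; split=> t /=.
  by move=> [n _ /D_gt0]; rewrite in_itv/= andbT.
rewrite in_itv/= andbT => t_gt0.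
pose m := maxn (Num.truncn t) (Num.truncn t^-1).
exists m => //; rewrite /D/= in_itv/=; apply/andP; split.
  rewrite -[leRHS]invrK lef_pV2 ?posrE ?invr_gt0//.
  rewrite ltW// (lt_le_trans (truncnS_gt _))// ler_nat.
  by rewrite -addn2 -addn1 leq_add// leq_maxr.
rewrite ltW// (lt_le_trans (truncnS_gt _))// ler_nat.
by rewrite -addn2 -addn1 leq_add// leq_maxl.
Qed.

Let within_continuous_D z n : {within D n, continuous (fun t : R => t `^ z * expR (- t))}.
Proof.
apply: derivable_within_continuous => t tD.
by have [] := is_derive_gamma_fun z (D_gt0 tD).
Qed.

(** Integration by parts, as the fundamental theorem of calculus for t^z e^(-t). Boundary values are
    written with [gamma_fun], whose limits at 0 and at infinity are known. *)
Let integral_D z n : 0 < z ->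
  (z%:E * \int[mu]_(t in D n) (t `^ (z - 1) * expR (- t))%:E =
   \int[mu]_(t in D n) (t `^ z * expR (- t))%:E +
   (gamma_fun z n.+2%:R - gamma_fun z (n.+2%:R)^-1)%:E)%E.
Proof.
move=> z_gt0.
have int_D x : mu.-integrable (D n) (EFin \o (fun t : R => t `^ x * expR (- t))).
  by apply: continuous_compact_integrable => //; exact: segment_compact.
have ab : (n.+2%:R : R)^-1 < n.+2%:R.
  by rewrite (@lt_trans _ _ 1)// ?invf_lt1 ?ltr1n ?ltr0n.
pose f (t : R) := t `^ z * expR (- t).
pose df (t : R) := z * (t `^ (z - 1) * expR (- t)) - f t.
have fE n' : gamma_fun z n'.+2%:R = f n'.+2%:R by rewrite /gamma_fun ltr0n.
have fVE : gamma_fun z n.+2%:R^-1 = f n.+2%:R^-1 by rewrite /gamma_fun invr_gt0 ltr0n.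
have f_cont (t : R) : 0 < t -> f s @[s --> t] --> f t.
  move=> /(is_derive_gamma_fun z)[/derivable1_diffP/differentiable_continuous + _].
  exact.
have FTC : (\int[mu]_(t in D n) (df t)%:E = (f n.+2%:R)%:E - (f n.+2%:R^-1)%:E)%E.
  apply: continuous_FTC2 => //.
  - rewrite /df => t; apply: cvgB; last exact: within_continuous_D.
    apply: cvgM; [exact: cvg_cst|exact: within_continuous_D].
  - split.
    + move=> t tD; have t_gt0 : 0 < t by apply: (@D_gt0 n); exact: subset_itv_oo_cc tD.
      by have [] := is_derive_gamma_fun z t_gt0.
    + by apply: cvg_at_right_filter; apply: f_cont; rewrite invr_gt0 ltr0n.
    + by apply: cvg_at_left_filter; apply: f_cont; rewrite ltr0n.
  - move=> t tD; have t_gt0 : 0 < t by apply: (@D_gt0 n); exact: subset_itv_oo_cc tD.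
    by rewrite derive1E; have [_ ->] := is_derive_gamma_fun z t_gt0.
rewrite fE fVE EFinB -FTC -integralZl//; [|exact: measurable_itv|exact: int_D].
have int_df : mu.-integrable (D n) (EFin \o df).
  rewrite (_ : EFin \o df =
    (fun t : R => z%:E * (t `^ (z - 1) * expR (- t))%R%:E)%E \- (EFin \o f))%E.
    apply: integrableB; [exact: measurable_itv| |exact: int_D].
    by apply: integrableZl; [exact: measurable_itv|exact: int_D].
  by apply/funext => t; rewrite /= /df EFinB EFinM.
rewrite -integralD//; [|exact: measurable_itv|exact: int_D].
by apply: eq_integral => t _ /=; rewrite -EFinD -EFinM /df /f; congr EFin; ring.
Qed.

Lemma GammaD1 z : 0 < z -> Gamma (z + 1) = z * Gamma z.
Proof.
move=> z_gt0.
rewrite /Gamma /Rintegral addrK -bigcup_D.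
have meas x n : measurable_fun (D n) (fun t : R => (t `^ x * expR (- t))%:E).
  apply/measurable_EFinP; apply: subspace_continuous_measurable_fun.
    exact: measurable_itv.
  exact: within_continuous_D.
have ndD : nondecreasing_seq D.
  move=> m n mn; apply/subsetPset; apply: subset_itv; rewrite bnd_simp.
    by rewrite lef_pV2 ?posrE ?ltr0n// ler_nat.
  by rewrite ler_nat.
pose I x n := (\int[mu]_(t in D n) (t `^ x * expR (- t))%:E)%E.
have lim x : I x n @[n --> \oo] -->
    (\int[mu]_(t in \bigcup_n D n) (t `^ x * expR (- t))%:E)%E.
  apply: ge0_nondecreasing_set_cvg_integral => //.
  - by move=> n; exact: measurable_itv.
  - by move=> n; exact: meas.
  - by move=> n t _; rewrite lee_fin mulr_ge0 ?powR_ge0 ?expR_ge0.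
(* The boundary terms vanish: by decay at the upper end, by continuity at 0 at the lower end. *)
have eps_cvg : (gamma_fun z n.+2%:R - gamma_fun z (n.+2%:R)^-1)%:E
    @[n --> \oo] --> 0%:E.
  have n2_cvg : (n.+2%:R : R) @[n --> \oo] --> +oo.
    apply/cvgryPge => A; near=> n; have : A <= n%:R by near: n; exact: nbhs_infty_ger.
    by move=> /le_trans; apply; rewrite ler_nat -addn2 leq_addr.
  have n2V_cvg : (n.+2%:R : R)^-1 @[n --> \oo] --> (0 : R).
    by apply/gtr0_cvgV0 => //; apply: nearW => n; rewrite ltr0n.
  apply: cvg_EFin; first exact: nearW.
  rewrite -[X in _ --> X](subr0 0); apply: cvgB.
    exact: (cvg_comp _ _ n2_cvg (gamma_fun_cvgy z_gt0)).
  have := cvg_comp _ _ n2V_cvg (continuous_gamma_fun z_gt0 (x := 0)).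
  by rewrite {2}/gamma_fun ltxx.
have zI_cvg : (z%:E * I (z - 1)%R n)%E @[n --> \oo] -->
    (z%:E * \int[mu]_(t in \bigcup_n D n) (t `^ (z - 1) * expR (- t))%:E)%E.
  exact: cvgeZl.
have J_cvg : (I z n + (gamma_fun z n.+2%:R - gamma_fun z (n.+2%:R)^-1)%:E)%E
    @[n --> \oo] --> (\int[mu]_(t in \bigcup_n D n) (t `^ z * expR (- t))%:E)%E.
  by rewrite -[X in _ --> X]adde0; apply: cvgeD => //; rewrite fin_num_adde_defl.
(* Both sides are limits of the same sequence, by monotone convergence along [D] and the identity on
   each [D n]. *)
have <- : (z%:E * \int[mu]_(t in \bigcup_n D n) (t `^ (z - 1) * expR (- t))%:E =
    \int[mu]_(t in \bigcup_n D n) (t `^ z * expR (- t))%:E)%E.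
  apply: (cvg_unique _ zI_cvg) => //.
  apply: cvg_trans J_cvg; apply: near_eq_cvg; apply: nearW => n.
  exact/esym/integral_D.
case: (\int[mu]_(t in _) _)%E => [r||] //=.
- by rewrite gt0_muley ?lte_fin// mulr0.
- by rewrite gt0_muleNy ?lte_fin// mulr0.
Unshelve. all: by end_near. Qed.
End Gamma_functional_equation.

(** * Stirling's ratio: its limit and the telescoped bounds *)

Definition stirling_ratio (R : realType) (z : R) : R :=
  Gamma z / (Num.sqrt (2 * pi) * z `^ (z - 1 / 2) * expR (- z)).

Definition ratio_step (R : realType) (z : R) : R :=
  expR ((z + 1 / 2) * ln (1 + z^-1) - 1).

Definition stirling_upper (R : realType) (z : R) : R :=
  1 + 1 / (12 * z) + 1 / (288 * z ^+ 2).

Section stirling_ratio.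
Context {R : realType}.
Implicit Types z w : R.
Local Notation mu := (@lebesgue_measure R).
Local Notation r := (@stirling_ratio R).
Local Notation c := (@ratio_step R).
Local Notation q := (@stirling_upper R).

Let s2pi_gt0 : 0 < Num.sqrt (2 * pi) :> R.
Proof. by rewrite sqrtr_gt0 mulr_gt0// pi_gt0. Qed.

(** Gamma(z) = Gamma(z + 1)/z, and the factor sqrt(z) of the substitution together with the one from
    z^(z - 1/2) cancels this z. *)
Lemma stirling_ratio_laplace z : 0 < z ->
  r z = (\int[mu]_u laplace z u) / Num.sqrt (2 * pi).
Proof.
move=> z_gt0; have zN0 := lt0r_neq0 z_gt0.
have sN0 : Num.sqrt z != 0 by rewrite gt_eqF// sqrtr_gt0.
have := Gamma_laplace z_gt0; rewrite GammaD1// => /(canRL (mulKf zN0)) GE.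
have pE : z `^ (z - 1 / 2) = z `^ z / Num.sqrt z.
  rewrite powRB; last by rewrite zN0 implybT.
  by rewrite div1r powR12_sqrt// ltW.
have pN0 : z `^ z != 0 by rewrite gt_eqF// powR_gt0.
have eN0 : expR (- z) != 0 by rewrite gt_eqF// expR_gt0.
have piN0 := lt0r_neq0 s2pi_gt0.
rewrite /stirling_ratio GE pE; move: sN0 eN0 piN0 pN0 zN0.
(* Expresses 1/z through sqrt(z), so that [field] sees the relation once the transcendental terms
   are generalized. *)
have zE : z^-1 = (Num.sqrt z ^+ 2)^-1 by rewrite sqr_sqrtr ?ltW.
rewrite zE.
move: (\int[mu]_u _) (Num.sqrt z) (Num.sqrt _) (expR _) (z `^ z) => I s p e t.
move=> sN0 eN0 pN0 tN0 zN0; field.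
by rewrite sN0 eN0 pN0 tN0.
Qed.

Lemma stirling_ratio_ge0 z : 0 < z -> 0 <= r z.
Proof.
move=> z_gt0; rewrite stirling_ratio_laplace// divr_ge0 ?sqrtr_ge0//.
by apply: Rintegral_ge0 => u _; exact: laplace_ge0.
Qed.

Lemma stirling_ratio_cvg1 (z : R ^nat) :
  (forall n, 1 <= z n) -> z @ \oo --> +oo ->
  r (z n) @[n --> \oo] --> (1 : R).
Proof.
move=> z_ge1 z_oo; rewrite -(divff (lt0r_neq0 s2pi_gt0)).
have E n : (\int[mu]_u laplace (z n) u) / Num.sqrt (2 * pi) = r (z n).
  by rewrite stirling_ratio_laplace// (lt_le_trans ltr01).
apply: cvg_trans; first by apply: near_eq_cvg; apply: nearW => n; exact: E.
by apply: cvgM; [exact: integral_laplace_cvg|exact: cvg_cst].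
Qed.

(** With every power and the factor z = e^(ln z) written as exponentials, the claim is an identity
    between exponents, linear in ln z and ln(z + 1). *)
Lemma stirling_ratioD1 z : 0 < z -> r z = c z * r (z + 1).
Proof.
move=> z_gt0; have zN0 := lt0r_neq0 z_gt0.
have z1_gt0 : 0 < z + 1 by lra.
have powE w : 0 < w -> w `^ (w - 1 / 2) = expR ((w - 1 / 2) * ln w).
  by move=> w_gt0; rewrite /powR gt_eqF.
have lnE : ln (1 + z^-1) = ln (z + 1) - ln z.
  by rewrite -ln_div ?posrE//; congr ln; field.
rewrite /stirling_ratio GammaD1// !powE// -!mulrA /ratio_step lnE.
have piN0 := lt0r_neq0 s2pi_gt0.
have -> : expR ((z + 1 / 2) * (ln (z + 1) - ln z) - 1) =
   expR ((z + 1 - 1 / 2) * ln (z + 1)) * expR (- (z + 1)) /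
   (expR ((z - 1 / 2) * ln z) * expR (- z) * expR (ln z)).
  by rewrite -!expRD -expRB; congr expR; field.
have eN0 x : expR x != 0 :> R by rewrite gt_eqF// expR_gt0.
by rewrite lnK ?posrE//; field; rewrite piN0 !eN0 zN0.
Qed.

Lemma ratio_step_gt1 z : 0 < z -> 1 < c z.
Proof.
move=> z_gt0; rewrite /ratio_step expR_gt1.
have := ln1D_gt (_ : 0 < z^-1); rewrite invr_gt0 => /(_ z_gt0).
rewrite (_ : 2 * z^-1 / (2 + z^-1) = (z + 1 / 2)^-1); last first.
  by field; rewrite !gt_eqF//; lra.
have h : 0 < z + 1 / 2 by lra.
rewrite -(ltr_pM2l h) divff ?gt_eqF// => ?; lra.
Qed.

Lemma stirling_upper_gt1 z : 0 < z -> 1 < q z.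
Proof.
move=> z_gt0; have z2_gt0 : 0 < z ^+ 2 by rewrite exprn_gt0.
have h1 : 0 < 1 / (12 * z) by rewrite div1r invr_gt0; lra.
have h2 : 0 < 1 / (288 * z ^+ 2) by rewrite div1r invr_gt0; lra.
by rewrite /stirling_upper; lra.
Qed.

(** With y = 1/(12 z), q(z) = a/2 and q(z + 1) = b/(2 u^2). Taking logarithms leaves exactly z times
    [upper_gap y] to be positive. *)
Lemma ratio_step_upper z : 0 < z -> c z * q (z + 1) < q z.
Proof.
move=> z_gt0; pose y := (12 * z)^-1.
have zN0 := lt0r_neq0 z_gt0.
have y_gt0 : 0 < y by rewrite invr_gt0 mulr_gt0.
pose a := 2 + 2 * y + y ^+ 2; pose b := 2 + 50 * y + 313 * y ^+ 2.
pose u := 1 + 12 * y.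
have a_gt0 : 0 < a by rewrite /a; nra.
have b_gt0 : 0 < b by rewrite /b; nra.
have u_gt0 : 0 < u by rewrite /u; lra.
have uE : 1 + z^-1 = u by rewrite /u /y; field.
have qE : q z = expR (ln a) / 2.
  by rewrite lnK ?posrE// /stirling_upper /a /y; field.
have qE1 : q (z + 1) = expR (ln b - 2 * ln u) / 2.
  rewrite expRB expRM_natl !lnK ?posrE// /stirling_upper -uE /b /y.
  by field; rewrite !gt_eqF//; lra.
have := upper_gap_gt0 y_gt0; rewrite /upper_gap -/a -/b -/u.
rewrite -(pmulr_rgt0 _ z_gt0).
have -> : z * (12 * y * (1 + ln a - ln b) + (18 * y - 1) * ln u) =
  1 + ln a - ln b + (3 / 2 - z) * ln u by rewrite /y; field.
move=> gap.
rewrite qE qE1 /ratio_step uE mulrA -expRD ltr_pM2r ?invr_gt0// ltr_expR.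
by lra.
Qed.

Lemma stirling_ratio_le_nat z n : 0 < z -> r (z + n%:R) <= r z.
Proof.
move=> z_gt0; elim: n => [|n]; first by rewrite addr0.
apply: le_trans; have w_gt0 : 0 < z + n%:R by rewrite ltr_wpDr.
rewrite -natr1 addrA (stirling_ratioD1 w_gt0) ler_peMl//.
  by rewrite stirling_ratio_ge0// addr_gt0.
by rewrite ltW// ratio_step_gt1.
Qed.

(** Cross-multiplied monotonicity of r/q along z + n: c(w) < q(w)/q(w + 1) gives r(w)/q(w) <= r(w +
    1)/q(w + 1). *)
Lemma stirling_ratio_upper_nat z n : 0 < z ->
  r z * q (z + n%:R) <= q z * r (z + n%:R).
Proof.
move=> z_gt0; elim: n => [|n IH]; first by rewrite addr0 mulrC.
have w_gt0 : 0 < z + n%:R by rewrite ltr_wpDr.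
have c_gt0 : 0 < c (z + n%:R) by rewrite expR_gt0.
rewrite -natr1 addrA -(ler_pM2l c_gt0).
rewrite [leRHS]mulrCA -stirling_ratioD1// mulrCA (le_trans _ IH)//.
by rewrite ler_wpM2l ?stirling_ratio_ge0// ltW// ratio_step_upper.
Qed.

(** Starting at z + 1 keeps every argument at least 1, as the domination requires, and saves the
    step from z to z + 1 for strictness. *)
Let shift_cvg z : 0 < z -> r (z + 1 + n%:R) @[n --> \oo] --> (1 : R).
Proof.
move=> z_gt0; apply: stirling_ratio_cvg1.
  by move=> n; rewrite -addrA addrCA lerDl addr_ge0// ltW.
apply/cvgryPge => A; near=> n.
have : A <= n%:R by near: n; exact: nbhs_infty_ger.
by move=> /le_trans; apply; rewrite lerDr; lra.
Unshelve. all: by end_near. Qed.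

(** The limit yields only r(z + 1) >= 1; the factor c(z) > 1 makes the inequality strict. *)
Lemma stirling_ratio_gt1 z : 0 < z -> 1 < r z.
Proof.
move=> z_gt0; have z1_gt0 : 0 < z + 1 by lra.
have r_ge1 : 1 <= r (z + 1).
  rewrite -[leLHS](cvg_lim _ (shift_cvg z_gt0))//; apply: limr_le.
    by apply/cvg_ex; exists 1; exact: shift_cvg.
  by apply: nearW => n; exact: stirling_ratio_le_nat.
rewrite stirling_ratioD1// (lt_le_trans (ratio_step_gt1 z_gt0))//.
by rewrite ler_peMr// ltW// expR_gt0.
Qed.

(** Again the limit gives a weak bound at z + 1, and the strict inequality for c(z) carries it to
    z. *)
Lemma stirling_ratio_lt_upper z : 0 < z -> r z < q z.
Proof.
move=> z_gt0; have z1_gt0 : 0 < z + 1 by lra.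
have r_le : r (z + 1) <= q (z + 1).
  have h : q (z + 1) * r (z + 1 + n%:R) @[n --> \oo] --> q (z + 1).
    rewrite -[X in _ --> X]mulr1.
    by apply: cvgM; [exact: cvg_cst|exact: shift_cvg].
  rewrite -[leRHS](cvg_lim _ h)//; apply: limr_ge.
    by apply/cvg_ex; exists (q (z + 1)).
  (* As q > 1, r(z + 1) <= r(z + 1) q(z + 1 + n); thus the limit of q itself is never computed. *)
  apply: nearW => n; apply: le_trans (stirling_ratio_upper_nat n z1_gt0).
  by rewrite ler_peMr ?stirling_ratio_ge0// ltW// stirling_upper_gt1// ltr_wpDr.
rewrite stirling_ratioD1// (le_lt_trans _ (ratio_step_upper z_gt0))//.
by rewrite ler_wpM2l// ltW// expR_gt0.
Qed.

End stirling_ratio.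

Theorem mainTheorem3 (R : realType) (z : R) (hz : 0 < z) :
  1 < Gamma z / (Num.sqrt (2 * pi) * z `^ (z - 1 / 2) * expR (- z))
    < 1 + 1 / (12 * z) + 1 / (288 * z ^+ 2).
Proof.
apply/andP; split; first exact: stirling_ratio_gt1.
exact: stirling_ratio_lt_upper.
Qed.
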